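(* Consider the system $\dot{\boldsymbol{z}}=A\boldsymbol{z}+B\boldsymbol{\mu}$ (i.e. $\ddot{\boldsymbol{r}}=\boldsymbol{\mu}$) controlled through (CBF-QP) as described in the context, with $\delta>0$. Suppose that: (i) $a_1,a_2>0$ are such that the roots of $\lambda^2+a_1\lambda+a_2$ are negative reals $-\lambda_1,-\lambda_2<0$; (ii) $\|\boldsymbol{r}(\tau_0)-\boldsymbol{r}^{\mathrm{ref}}(\tau_0)\|_\infty\le\delta$ and $\|\dot{\boldsymbol{r}}(\tau_0)-\dot{\boldsymbol{r}}^{\mathrm{ref}}(\tau_0)+\lambda_1(\boldsymbol{r}(\tau_0)-\boldsymbol{r}^{\mathrm{ref}}(\tau_0))\|_\infty\le\lambda_1\delta$; (iii) the solution $\boldsymbol{\mu}^*$ of (CBF-QP) is locally Lipschitz in $\boldsymbol{z}$. Let $0<\epsilon<\pi/2$ be the given upper bound for $|\phi|$ and $|\theta|$, and let $\overline T$ be the given upper bound for $T$. If the trajectories $\boldsymbol{z}^{\mathrm{ref}}(t)$ and $\boldsymbol{v}^{\mathrm{ref}}(t)$ are dynamically feasible, i.e. $\ddot{\boldsymbol{r}}^{\mathrm{ref}}(t)=\Psi(\boldsymbol{v}^{\mathrm{ref}}(t))$, and the following conditions hold for all $t\in[\tau_0,\tau_v)$: $$0\le T^{\mathrm{ref}}(t)\le\overline T-4\sqrt3\,\delta a_2,$$ $$\|A_\epsilon\ddot{\boldsymbol{r}}^{\mathrm{ref}}(t)\|_2\le\ddot z^{\mathrm{ref}}(t)+g-4\delta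 a_2\,(1+|\cot\epsilon|\sqrt2),$$ where $A_\epsilon=|\cot\epsilon|\,\mathrm{diag}(1,1,0)$ and $T^{\mathrm{ref}}$ is the thrust component of $\boldsymbol{v}^{\mathrm{ref}}$, then $\boldsymbol{v}_s(t)\in\mathcal{V}$ for all $t\in[\tau_0,\tau_v)$, where $$\mathcal{V}=\{(T,\phi,\theta,\psi)^T\in\mathbb{R}^4:\ 0\le T\le\overline T,\ |\phi|\le\epsilon,\ |\theta|\le\epsilon\}.$$
   Context: State $\boldsymbol{z}=(x,y,z,\dot x,\dot y,\dot z)^T\in\mathbb{R}^6$, with position $\boldsymbol{r}=(x,y,z)^T$ and velocity $\dot{\boldsymbol{r}}=(\dot x,\dot y,\dot z)^T$; $A=\begin{bmatrix}0_3 & I_3 \\ 0_3 & 0_3\end{bmatrix}$, $B=\begin{bmatrix}0_3 \\ I_3\end{bmatrix}$. Physical input $\boldsymbol{v}=(T,\phi,\theta,\psi)^T$ (normalized thrust, roll, pitch, yaw). The virtual input is $\boldsymbol{\mu}=(\mu_1,\mu_2,\mu_3)^T=\Psi(\boldsymbol{v}):=T\boldsymbol{z}_B-g\boldsymbol{z}_W$, where $g>0$ is gravity, $\boldsymbol{z}_W=(0,0,1)^T$, and $\boldsymbol{z}_B=(\sin\phi\sin\psi+\cos\phi\sin\theta\cos\psi,\ \cos\phi\sin\theta\sin\psi-\sin\phi\cos\psi,\ \cos\phi\cos\theta)^T$. Given yaw $\psi$, $\Psi$ is inverted by $\boldsymbol{v}=\Psi^{-1}(\boldsymbol{\mu},\psi)$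 with $T=\sqrt{\mu_1^2+\mu_2^2+(\mu_3+g)^2}$, $\theta=\arctan\frac{\mu_1\cos\psi+\mu_2\sin\psi}{\mu_3+g}$, $\phi=\arctan\frac{\mu_1\sin\psi-\mu_2\cos\psi}{(\mu_3+g)\cos\theta}$. A reference position trajectory $\boldsymbol{r}^{\mathrm{ref}}=(x^{\mathrm{ref}},y^{\mathrm{ref}},z^{\mathrm{ref}})^T$ on $[\tau_0,\tau_v)$ is given, three times continuously differentiable, with reference state $\boldsymbol{z}^{\mathrm{ref}}=(\boldsymbol{r}^{\mathrm{ref}},\dot{\boldsymbol{r}}^{\mathrm{ref}})$ and reference input $\boldsymbol{v}^{\mathrm{ref}}=(T^{\mathrm{ref}},\phi^{\mathrm{ref}},\theta^{\mathrm{ref}},\psi^{\mathrm{ref}})^T$. A nominal (possibly unsafe) controller $\boldsymbol{v}=\pi(\boldsymbol{z})$ is given. (CBF-QP), at $(t,\boldsymbol{z})$: minimize $\|\Psi(\pi(\boldsymbol{z}))-\boldsymbol{\mu}\|_2^2$ over $\boldsymbol{\mu}\in\mathbb{R}^3$ subject to, for each $q\in\{x,y,z\}$ (with $\mu_q$ denoting $\mu_1,\mu_2,\mu_3$ for $q=x,y,z$ respectively), $$\mu_q-\ddot q^{\mathrm{ref}}(t)+a_1(\dot q-\dot q^{\mathrm{ref}}(t))+a_2(q-q^{\mathrm{ref}}(t)-\delta)\le0,$$ $$-\mu_q+\ddot q^{\mathrm{ref}}(t)+a_1(\dot q^{\mathrm{ref}}(t)-\dot q)+a_2(q^{\mathrm{ref}}(t)-q-\delta)\le0.$$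 Its solution is denoted $\boldsymbol{\mu}^*=\boldsymbol{\mu}^*(t,\boldsymbol{z})$, and $\boldsymbol{\mu}^*(t)=\boldsymbol{\mu}^*(t,\boldsymbol{z}(t))$ along a trajectory. The safe input is $\boldsymbol{v}_s(t)=\Psi^{-1}(\boldsymbol{\mu}^*(t),\psi(t))$, with $\psi(t)$ the yaw component of $\pi(\boldsymbol{z}(t))$; applying it to the quadcopter means that the virtual input is $\boldsymbol{\mu}^*(t)$, i.e. $\boldsymbol{z}(t)$ is the closed-loop trajectory $\dot{\boldsymbol{z}}(t)=A\boldsymbol{z}(t)+B\boldsymbol{\mu}^*(t)$ on $[\tau_0,\tau_v)$.
   Formalization: The roots are labelled so that λ₁ ≤ λ₂ (the claim fails for λ₁ > λ₂), and in Ψ⁻¹ the printed φ is corrected to arctan((μ₁ sin ψ − μ₂ cos ψ) cos θ/(μ₃+g)), since the printed formula does not invert Ψ and makes the claim false. *)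

(* Defs.v *)
From HB Require Import structures.
From mathcomp Require Export all_boot all_order all_algebra.
From mathcomp Require Export all_classical all_reals.
From mathcomp Require Export ereal topology normedtype trigo.
From mathcomp Require Import ring lra.
Export Order.TTheory GRing.Theory Num.Theory.
Export numFieldNormedType.Exports.

Set Implicit Arguments.
Unset Strict Implicit.
Unset Printing Implicit Defensive.

Local Open Scope classical_set_scope.
Local Open Scope ring_scope.

Section Vectors.
Context {R : realType}.
Implicit Types (a b c d : R).

Definition vec3 a b c : 'cV[R]_3 := \col_(i < 3) [:: a; b; c]`_i.
Definition vec4 a b c d : 'cV[R]_4 := \col_(i < 4) [:: a; b; c; d]`_i.

(* The library norm `|v| on matrices is the maximum norm. *)
Definition norm2 n (v : 'cV[R]_n) : R := Num.sqrt (\sum_(i < n) v i 0 ^+ 2).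

Definition cot a : R := cos a / sin a.

(* [tau0, tauv); the right end may be infinite. *)
Definition horizon (tau0 : R) (tauv : \bar R) : set R :=
  [set t | tau0 <= t /\ (t%:E < tauv)%E].

(* Derivative relative to D: one-sided at an end point of D. *)
Definition is_derivative_in (D : set R) (V : normedModType R)
    (f f' : R -> V) : Prop :=
  forall t, D t ->
    (s - t)^-1 *: (f s - f t) @[s --> within D t^'] --> f' t.

Definition locally_lipschitz (V W : normedModType R) (f : V -> W) : Prop :=
  forall x : V, exists2 U : set V, nbhs x U & [lipschitz f y | y in U].

End Vectors.

Section Quadcopter.
Context {R : realType}.
Implicit Types (g psi delta : R) (z : 'cV[R]_(3 + 3)) (mu : 'cV[R]_3).
Implicit Type v : 'cV[R]_4.

Definition position z : 'cV[R]_3 := usubmx z.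
Definition velocity z : 'cV[R]_3 := dsubmx z.

Definition Amx : 'M[R]_(3 + 3) := block_mx 0 1%:M 0 0.
Definition Bmx : 'M[R]_(3 + 3, 3) := col_mx 0 1%:M.

Definition thrust v : R := v 0 0.
Definition roll v : R := v 1 0.
Definition pitch v : R := v 2 0.
Definition yaw v : R := v 3 0.

Definition zW : 'cV[R]_3 := vec3 0 0 1.

Definition zB v : 'cV[R]_3 :=
  let phi := roll v in let theta := pitch v in let psi := yaw v in
  vec3 (sin phi * sin psi + cos phi * sin theta * cos psi)
       (cos phi * sin theta * sin psi - sin phi * cos psi)
       (cos phi * cos theta).

Definition Psi g v : 'cV[R]_3 := thrust v *: zB v - g *: zW.

(* Inverse of Psi at a given yaw.  Since, for mu = Psi v,
     mu1 cos psi + mu2 sin psi = T cos phi sin theta,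
     mu1 sin psi - mu2 cos psi = T sin phi,
     mu3 + g                   = T cos phi cos theta,
   the factor cos theta in tan phi multiplies the quotient; putting it in the
   denominator would not invert Psi (see PsiK and Psi_invK). *)
Definition Psi_inv g mu psi : 'cV[R]_4 :=
  let m1 := mu 0 0 in let m2 := mu 1 0 in let m3 := mu 2 0 in
  let T := Num.sqrt (m1 ^+ 2 + m2 ^+ 2 + (m3 + g) ^+ 2) in
  let theta := atan ((m1 * cos psi + m2 * sin psi) / (m3 + g)) in
  let phi := atan ((m1 * sin psi - m2 * cos psi) / (m3 + g) * cos theta) in
  vec4 T phi theta psi.

(* Here r, dr, ddr are the values at the current time of the reference
   position and of its first two derivatives. *)
Definition qp_feasible (a1 a2 delta : R) (r dr ddr : 'cV[R]_3) z mu : Prop :=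
  forall q : 'I_3,
    mu q 0 - ddr q 0 + a1 * (velocity z q 0 - dr q 0)
      + a2 * (position z q 0 - r q 0 - delta) <= 0 /\
    - mu q 0 + ddr q 0 + a1 * (dr q 0 - velocity z q 0)
      + a2 * (r q 0 - position z q 0 - delta) <= 0.

Definition qp_solution (g a1 a2 delta : R) (r dr ddr : 'cV[R]_3)
    (ctrl : 'cV[R]_(3 + 3) -> 'cV[R]_4) z mu : Prop :=
  qp_feasible a1 a2 delta r dr ddr z mu /\
  forall nu, qp_feasible a1 a2 delta r dr ddr z nu ->
    norm2 (Psi g (ctrl z) - mu) ^+ 2 <= norm2 (Psi g (ctrl z) - nu) ^+ 2.

Definition Aeps (eps : R) : 'M[R]_3 := `|cot eps| *: diag_mx (vec3 1 1 0)^T.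

Definition safe_inputs (Tbar eps : R) : set 'cV[R]_4 :=
  [set v | 0 <= thrust v <= Tbar /\ `|roll v| <= eps /\ `|pitch v| <= eps].

Lemma Psi_invK g mu psi : 0 < mu 2 0 + g -> Psi g (Psi_inv g mu psi) = mu.
Proof.
move=> d0; pose m1 := mu 0 0; pose m2 := mu 1 0; pose d := mu 2 0 + g.
pose c := cos psi; pose s := sin psi.
pose p := m1 * c + m2 * s; pose q := m1 * s - m2 * c.
have cs : c ^+ 2 + s ^+ 2 = 1 by rewrite cos2Dsin2.
pose T := Num.sqrt (m1 ^+ 2 + m2 ^+ 2 + d ^+ 2).
pose th := atan (p / d); pose ph := atan (q / d * cos th).
have T0 : 0 < T by rewrite sqrtr_gt0 ltr_wpDl ?addr_ge0 ?sqr_ge0 ?exprn_gt0.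
have T2 : T ^+ 2 = m1 ^+ 2 + m2 ^+ 2 + d ^+ 2.
  by rewrite sqr_sqrtr// !addr_ge0 ?sqr_ge0.
have cth0 : 0 < cos th by rewrite cos_gt0_pihalf// atan_gtNpi2 atan_ltpi2.
have cph0 : 0 < cos ph by rewrite cos_gt0_pihalf// atan_gtNpi2 atan_ltpi2.
have dn0 : d != 0 by rewrite gt_eqF.
have sth : d * sin th = p * cos th.
  have : tan th = p / d by rewrite atanK.
  rewrite /tan => /(canRL (divfK (lt0r_neq0 cth0))) ->.
  by rewrite mulrA (mulrC d) divfK.
have sph : d * sin ph = q * cos th * cos ph.
  have : tan ph = q / d * cos th by rewrite atanK.
  rewrite /tan => /(canRL (divfK (lt0r_neq0 cph0))) ->.
  by field.
have eth : (d ^+ 2 + p ^+ 2) * cos th ^+ 2 = d ^+ 2.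
  rewrite mulrDl -[X in _ + X]exprMn -sth exprMn -mulrDr cos2Dsin2 mulr1 //.
have eph : (d ^+ 2 + q ^+ 2 * cos th ^+ 2) * cos ph ^+ 2 = d ^+ 2.
  by rewrite mulrDl -!exprMn -sph !exprMn -mulrDr cos2Dsin2 mulr1.
have m12 : m1 ^+ 2 + m2 ^+ 2 = p ^+ 2 + q ^+ 2.
  transitivity ((m1 ^+ 2 + m2 ^+ 2) * (c ^+ 2 + s ^+ 2)); first by rewrite cs mulr1.
  by rewrite /p /q; ring.
have TC : T * cos ph * cos th = d.
  apply/eqP; rewrite -(@eqrXn2 _ 2)//; last 2 first.
  - by rewrite !mulr_ge0 // ltW.
  - exact: ltW.
  apply/eqP; rewrite !exprMn T2 m12 -[RHS]eph -[in RHS]eth.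
  by ring.
have P : T * (cos ph * sin th) = p.
  apply: (mulfI dn0); transitivity (T * cos ph * (d * sin th)); first by ring.
  by rewrite sth -[in RHS]TC; ring.
have Q : T * sin ph = q.
  by apply: (mulfI dn0); rewrite mulrCA sph -[in RHS]TC; ring.
apply/colP => i; rewrite /Psi /thrust /zB /roll /pitch /yaw !mxE /=.
rewrite -/m1 -/m2 -/d -/T -/c -/s -/p -/q -/th -/ph.
have [->|[->|->]] : i = 0 \/ i = 1 \/ i = 2.
- by case: i => [[|[|[|//]]] ?]; [left|right; left|right; right]; exact/val_inj.
- rewrite /= mulr0 subr0.
  transitivity (T * sin ph * s + T * (cos ph * sin th) * c); first by ring.
  rewrite P Q; transitivity (m1 * (c ^+ 2 + s ^+ 2)); last by rewrite cs mulr1.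
  by rewrite /p /q; ring.
- rewrite /= mulr0 subr0.
  transitivity (T * (cos ph * sin th) * s - T * sin ph * c); first by ring.
  rewrite P Q; transitivity (m2 * (c ^+ 2 + s ^+ 2)); last by rewrite cs mulr1.
  by rewrite /p /q; ring.
- by rewrite /= mulr1 mulrA TC /d addrK.
Qed.

Lemma PsiK g v : 0 < thrust v ->
  - (pi / 2) < roll v < pi / 2 -> - (pi / 2) < pitch v < pi / 2 ->
  Psi_inv g (Psi g v) (yaw v) = v.
Proof.
move=> T0 phB thB; have cph0 := cos_gt0_pihalf phB.
have cth0 := cos_gt0_pihalf thB.
pose ph := roll v; pose th := pitch v; pose ps := yaw v; pose T := thrust v.
pose s := sin ps; pose c := cos ps.
have cs : c ^+ 2 + s ^+ 2 = 1 by rewrite cos2Dsin2.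
have Psi0 : Psi g v 0 0 = T * (sin ph * s + cos ph * sin th * c).
  by rewrite !mxE /= mulr0 subr0.
have Psi1 : Psi g v 1 0 = T * (cos ph * sin th * s - sin ph * c).
  by rewrite !mxE /= mulr0 subr0.
have Psi2 : Psi g v 2 0 + g = T * (cos ph * cos th).
  by rewrite !mxE /= mulr1 subrK.
have P : Psi g v 0 0 * c + Psi g v 1 0 * s = T * (cos ph * sin th).
  rewrite Psi0 Psi1; transitivity (T * (cos ph * sin th) * (c ^+ 2 + s ^+ 2)).
    by ring.
  by rewrite cs mulr1.
have Q : Psi g v 0 0 * s - Psi g v 1 0 * c = T * sin ph.
  rewrite Psi0 Psi1; transitivity (T * sin ph * (c ^+ 2 + s ^+ 2)).
    by ring.
  by rewrite cs mulr1.
have TE : Num.sqrt (Psi g v 0 0 ^+ 2 + Psi g v 1 0 ^+ 2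
                    + (Psi g v 2 0 + g) ^+ 2) = T.
  rewrite -[RHS]gtr0_norm// -sqrtr_sqr; congr Num.sqrt.
  transitivity (T ^+ 2 * (sin ph ^+ 2 * (c ^+ 2 + s ^+ 2)
     + cos ph ^+ 2 * (sin th ^+ 2 * (c ^+ 2 + s ^+ 2) + cos th ^+ 2))).
    by rewrite Psi0 Psi1 Psi2; ring.
  by rewrite cs !mulr1 [sin th ^+ 2 + _]addrC cos2Dsin2 mulr1 addrC cos2Dsin2
    mulr1.
have Tn0 : T != 0 by rewrite gt_eqF.
have cphn0 : cos ph != 0 by rewrite gt_eqF.
have cthn0 : cos th != 0 by rewrite gt_eqF.
have thE : atan (T * (cos ph * sin th) / (T * (cos ph * cos th))) = th.
  rewrite -[RHS]tanK ?in_itv//; congr atan; rewrite /tan.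
  by field; rewrite Tn0 cphn0 cthn0.
have phE : atan (T * sin ph / (T * (cos ph * cos th)) * cos th) = ph.
  rewrite -[RHS]tanK ?in_itv//; congr atan; rewrite /tan.
  by field; rewrite Tn0 cphn0 cthn0.
apply/colP => i; rewrite /Psi_inv mxE P Q TE Psi2 thE phE.
have [->|[->|[->|->]]] // : i = 0 \/ i = 1 \/ i = 2 \/ i = 3.
by case: i => [[|[|[|[|//]]]] ?];
  [left|right; left|right; right; left|right; right; right]; exact/val_inj.
Qed.

End Quadcopter.

(* Main.v *)
(** Per coordinate, the CBF-QP constraints say that the tracking error [e]
    satisfies [|e'' + a1 e' + a2 e| <= a2 delta].  Since [a1 = l1 + l2] and
    [a2 = l1 l2], this equation is a cascade of two first-order filters: the
    left-hand side is [s' + l2 s] with [s = e' + l1 e].  Hence [|s| <= l1 delta]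
    and then [|e| <= delta] are preserved, and [l1 <= l2] gives
    [|e''| <= 4 delta a2], i.e. the virtual input stays within [4 delta a2] of
    the reference acceleration in each coordinate.  The margins
    [4 sqrt 3 delta a2] and [4 delta a2 (1 + |cot eps| sqrt 2)] of the
    hypotheses absorb this deviation in the thrust bound [|mu + g zW| <= Tbar]
    and in the cone condition [|Aeps mu| <= mu3 + g], the latter being what
    bounds both angles. *)

Require Import Defs.
From mathcomp Require Import sequences derive realfun exp.
From mathcomp Require Import ring lra.

Set Implicit Arguments.
Unset Strict Implicit.
Unset Printing Implicit Defensive.

Local Open Scope classical_set_scope.
Local Open Scope ring_scope.

(** * Calculus of derivatives relative to a set *)

Section DerivativeWithin.
Context {R : realType}.
Implicit Types (D : set R) (V W : normedModType R).

Lemma is_derivative_inD D V (f g f' g' : R -> V) :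
  is_derivative_in D f f' -> is_derivative_in D g g' ->
  is_derivative_in D (fun t => f t + g t) (fun t => f' t + g' t).
Proof.
move=> df dg t Dt.
rewrite (_ : (fun s => _) = (fun s => (s - t)^-1 *: (f s - f t)) \+
                            (fun s => (s - t)^-1 *: (g s - g t))).
  by apply: cvgD; [exact: df|exact: dg].
by apply/funext => s /=; rewrite -scalerDr opprD addrACA.
Qed.

Lemma is_derivative_inZ D V k (f f' : R -> V) :
  is_derivative_in D f f' ->
  is_derivative_in D (fun t => k *: f t) (fun t => k *: f' t).
Proof.
move=> df t Dt.
rewrite (_ : (fun s => _) = (fun s => k *: ((s - t)^-1 *: (f s - f t)))).
  by apply: cvgZ; [exact: cvg_cst|exact: df].
by apply/funext => s /=; rewrite -scalerBr !scalerA mulrC.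
Qed.

Lemma is_derivative_inN D V (f f' : R -> V) :
  is_derivative_in D f f' ->
  is_derivative_in D (fun t => - f t) (fun t => - f' t).
Proof.
move=> df; rewrite (_ : (fun t => - f t) = (fun t => -1 *: f t)).
  rewrite (_ : (fun t => - f' t) = (fun t => -1 *: f' t)).
    exact: is_derivative_inZ.
  by apply/funext => t; rewrite scaleN1r.
by apply/funext => t; rewrite scaleN1r.
Qed.

(** Entry evaluation is linear and continuous, so it passes through difference quotients and their
    limits. *)
Lemma is_derivative_in_coord D m n (f f' : R -> 'M[R]_(m, n)) i j :
  is_derivative_in D f f' ->
  is_derivative_in D (fun t => f t i j : R^o) (fun t => f' t i j).
Proof.
move=> df t Dt.
rewrite (_ : (fun s => _) = (fun M : 'M[R]_(m, n) => M i j) \o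
                            (fun s => (s - t)^-1 *: (f s - f t))).
  apply: cvg_comp; first exact: df.
  exact: coord_continuous.
by apply/funext => s /=; rewrite !mxE.
Qed.

(** For [s != t], [f s] is [f t] plus [s - t] times a convergent difference quotient; the point
    [s = t], excluded from the punctured filter, is treated apart. *)
Lemma is_derivative_in_continuous D V (f f' : R -> V) :
  is_derivative_in D f f' -> {within D, continuous f}.
Proof.
move=> df; apply/subspace_continuousP => t Dt.
have dft : f t + (s - t) *: ((s - t)^-1 *: (f s - f t))
    @[s --> within D t^'] --> f t.
  rewrite -[X in _ --> X]addr0 -(scale0r (f' t)) -(subrr t).
  apply: cvgD; first exact: cvg_cst.
  apply: cvgZ; last exact: df.
  apply: cvgB; last exact: cvg_cst.
  apply: cvg_trans (@nbhs_dnbhs _ t).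
  exact: (cvg_within (F := t^')).
move=> U Uft.
have dftU : nbhs t (fun s => s != t -> D s ->
    U (f t + (s - t) *: ((s - t)^-1 *: (f s - f t)))) by exact: dft.
suff : nbhs t (fun s => D s -> U (f s)) by [].
apply: filterS dftU => s sU Ds; have [->|st] := eqVneq s t.
  exact: nbhs_singleton.
by move: (sU st Ds); rewrite scalerA divff ?subr_eq0// scale1r subrKC.
Qed.

(** Near an interior point the restriction to [D] disappears, which gives access to the theorems on
    two-sided derivatives. *)
Lemma is_derivative_in_interior D V (f f' : R -> V) t :
  is_derivative_in D f f' -> nbhs t D -> is_derive t 1 f (f' t).
Proof.
move=> df Dt.
have shift_dnbhs : h + t @[h --> 0^'] --> within D t^'.
  move=> U tU.
  have ht : h + t @[h --> (0 : R)] --> t.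
    rewrite -[X in _ --> X]add0r.
    by apply: cvgD; [exact: cvg_id|exact: cvg_cst].
  have Ut : nbhs t (fun s => s != t -> U s).
    have tU' : nbhs t (fun s => s != t -> D s -> U s) by exact: tU.
    by apply: filterS2 tU' Dt => s + Ds => /[apply]; exact.
  have : nbhs (0 : R) (fun h => h + t != t -> U (h + t)) by exact: ht Ut.
  move=> htU; suff : nbhs (0 : R) (fun h => h != 0 -> U (h + t)) by [].
  by apply: filterS htU => h Uh h0; apply: Uh; rewrite -subr_eq0 addrK.
have dft : h^-1 *: (f (h *: 1 + t) - f t) @[h --> (0 : R)^'] --> f' t.
  rewrite (_ : (fun h : R => _) =
      (fun s => (s - t)^-1 *: (f s - f t)) \o (fun h => h + t)).
    exact: cvg_comp shift_dnbhs (df t (nbhs_singleton Dt)).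
  by apply/funext => h /=; rewrite addrK [h *: 1]mulr1.
by split; [apply/cvg_ex; exists (f' t)|exact: cvg_lim dft].
Qed.

End DerivativeWithin.

(** * Comparison for linear differential inequalities *)

Section Comparison.
Context {R : realType}.

(* The integrating factor [expR (lam * t)] makes [y - c] nonincreasing. *)
Lemma linear_differential_le (tau0 : R) (tauv : \bar R) (lam c : R)
    (y y' : R -> R^o) :
  is_derivative_in (horizon tau0 tauv) y y' ->
  (forall t, horizon tau0 tauv t -> y' t + lam * y t <= lam * c) ->
  y tau0 <= c -> forall t, horizon tau0 tauv t -> y t <= c.
Proof.
move=> dy ley y0 t [tau0t ttauv].
have subD s : tau0 <= s -> s <= t -> horizon tau0 tauv s.
  by move=> ? st; split => //; apply: le_lt_trans ttauv; rewrite lee_fin.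
pose f (s : R) : R := expR (lam * s) * (y s - c).
have df s : s \in `]tau0, t[%R ->
    is_derive s 1 f (expR (lam * s) * (y' s + lam * (y s - c))).
  rewrite in_itv/= => /andP[s0 s1].
  have ? : is_derive s 1 y (y' s).
    apply: (is_derivative_in_interior dy).
    apply: filterS (@near_in_itvoo _ tau0 t s _).
      move=> u; rewrite in_itv/= => /andP[u0 u1].
      by apply: subD; exact: ltW.
    by rewrite in_itv/= s0.
  have ? : is_derive s 1 (fun u : R => expR (lam * u)) (expR (lam * s) * lam).
    apply: (@is_derive1_comp _ expR ( *%R lam)).
    by rewrite (_ : *%R lam = lam *: id)//; apply: is_derive_eq;
      rewrite [_%:A]mulr1.
  rewrite (_ : f = (fun u => expR (lam * u)) * (y - cst c))//.
  apply: is_derive_eq; rewrite subr0 /= /GRing.scale/=.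
  by rewrite !fctE; ring.
have fnincr : f t <= f tau0.
  apply: (@ler0_derive1_le_cc _ f tau0 t); rewrite ?in_itv/= ?lexx ?tau0t//.
  - by move=> s /df [].
  - move=> s sI; have [_ fs] := df s sI; rewrite derive1E fs.
    rewrite pmulr_rle0 ?expR_gt0//.
    move: sI; rewrite in_itv/= => /andP[/ltW s0 /ltW s1].
    by rewrite mulrBr addrA subr_le0; apply: ley; exact: subD.
  (* [df] covers the open interval only; continuity up to its end points comes from the derivative
     within the horizon. *)
  - apply: (@continuous_subspaceW _ _ _ (horizon tau0 tauv)).
      by move=> s; rewrite /= in_itv/= => /andP[]; exact: subD.
    have /subspace_continuousP yc := is_derivative_in_continuous dy.
    apply/subspace_continuousP => s Ds; apply: cvgM; last first.
      by apply: cvgB; [exact: yc|exact: cvg_cst].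
    apply: cvg_within_filter; apply: continuous_comp;
      last exact: continuous_expR.
    by apply: cvgM; [exact: cvg_cst|exact: cvg_id].
have : f t <= 0.
  by apply: le_trans fnincr _; rewrite pmulr_rle0 ?expR_gt0// subr_le0.
by rewrite pmulr_rle0 ?expR_gt0// subr_le0.
Qed.

(** The one-sided comparison applies to both [y] and [- y]. *)
Lemma linear_differential_norm_le (tau0 : R) (tauv : \bar R) (lam c : R)
    (y y' : R -> R^o) :
  is_derivative_in (horizon tau0 tauv) y y' ->
  (forall t, horizon tau0 tauv t -> `|y' t + lam * y t| <= lam * c) ->
  `|y tau0| <= c -> forall t, horizon tau0 tauv t -> `|y t| <= c.
Proof.
move=> dy ley /ler_normlP[Ny0 y0] t tD; apply/ler_normlP; split.
- apply: (linear_differential_le (lam := lam) (is_derivative_inN dy))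
    Ny0 t tD => s sD.
  by rewrite mulrN -opprD; have /ler_normlP[] := ley s sD.
- apply: (linear_differential_le (lam := lam) dy) y0 t tD => s sD.
  by have /ler_normlP[] := ley s sD.
Qed.

Lemma second_order_norm_le (tau0 : R) (tauv : \bar R) (l1 l2 delta : R)
    (e e' e'' : R -> R^o) :
  0 < l1 -> l1 <= l2 ->
  is_derivative_in (horizon tau0 tauv) e e' ->
  is_derivative_in (horizon tau0 tauv) e' e'' ->
  (forall t, horizon tau0 tauv t ->
     `|e'' t + (l1 + l2) * e' t + l1 * l2 * e t| <= l1 * l2 * delta) ->
  `|e tau0| <= delta -> `|e' tau0 + l1 * e tau0| <= l1 * delta ->
  forall t, horizon tau0 tauv t -> `|e'' t| <= 4 * delta * (l1 * l2).
Proof.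
move=> l1_gt0 l12 de de' ule e0 s0 t tD.
have delta_ge0 : 0 <= delta := le_trans (normr_ge0 _) e0.
have sle u : horizon tau0 tauv u -> `|e' u + l1 * e u| <= l1 * delta.
  have ds := is_derivative_inD de' (is_derivative_inZ (k := l1) de).
  apply: (linear_differential_norm_le (lam := l2) ds) => // v vD.
  have := ule v vD; congr (`|_| <= _); last by ring.
  by rewrite /GRing.scale/=; ring.
have ele u : horizon tau0 tauv u -> `|e u| <= delta.
  exact: linear_differential_norm_le de sle e0 u.
have := ule t tD; have := sle t tD; have := ele t tD.
rewrite !ler_norml => /andP[? ?] /andP[? ?] /andP[? ?].
(* With [s = e' + l1 e] and [w] the quantity bounded by [ule], [e'' = w - (l1 + l2) s + l1^2 e].
   Hence [|e''| <= 2 delta l1 (l1 + l2)], and [l1 <= l2] yields the factor 4. *)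
by apply/andP; split; nra.
Qed.

End Comparison.

(** * The Euclidean norm on column vectors *)

Section EuclideanNorm.
Context {R : realType}.

Lemma norm2_ge0 n (v : 'cV[R]_n) : 0 <= norm2 v.
Proof. exact: sqrtr_ge0. Qed.

Lemma sqr_norm2 n (v : 'cV[R]_n) : norm2 v ^+ 2 = \sum_(i < n) v i 0 ^+ 2.
Proof. by rewrite sqr_sqrtr// sumr_ge0// => i _; exact: sqr_ge0. Qed.

Lemma norm2Z n k (v : 'cV[R]_n) : norm2 (k *: v) = `|k| * norm2 v.
Proof.
rewrite -sqrtr_sqr -sqrtrM ?sqr_ge0// mulr_sumr; congr Num.sqrt.
by apply: eq_bigr => i _; rewrite mxE exprMn.
Qed.

Lemma norm2_eq0 n (v : 'cV[R]_n) : norm2 v = 0 -> v = 0.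
Proof.
move=> v0; apply/colP => i; rewrite mxE; apply/eqP; rewrite -sqrf_eq0.
have /eqP : norm2 v ^+ 2 = 0 by rewrite v0 expr0n.
rewrite sqr_norm2 psumr_eq0 => [/allP/(_ i)|j _]; last exact: sqr_ge0.
by rewrite mem_index_enum; exact.
Qed.

(** For nonzero vectors, the sum of the squares of [norm2 v * u_i - norm2 u * v_i] equals
    [2 * norm2 u * norm2 v] times the gap in the inequality. *)
Lemma norm2_cauchy_schwarz n (u v : 'cV[R]_n) :
  \sum_(i < n) u i 0 * v i 0 <= norm2 u * norm2 v.
Proof.
have [/norm2_eq0 ->|u0] := eqVneq (norm2 u) 0.
  by rewrite big1 ?mulr_ge0 ?norm2_ge0// => i _; rewrite mxE mul0r.
have [/norm2_eq0 ->|v0] := eqVneq (norm2 v) 0.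
  by rewrite big1 ?mulr_ge0 ?norm2_ge0// => i _; rewrite mxE mulr0.
have uv_gt0 : 0 < norm2 u * norm2 v.
  by rewrite mulr_gt0 // lt0r norm2_ge0 ?u0 ?v0.
rewrite -(ler_pM2l uv_gt0) -subr_ge0 -(pmulr_rge0 _ (ltr0n _ 2))//.
rewrite (_ : 2 * _ = \sum_(i < n) (norm2 v * u i 0 - norm2 u * v i 0) ^+ 2).
  by apply: sumr_ge0 => i _; exact: sqr_ge0.
transitivity (norm2 v ^+ 2 * \sum_(i < n) u i 0 ^+ 2
    + norm2 u ^+ 2 * \sum_(i < n) v i 0 ^+ 2
    - 2 * norm2 u * norm2 v * \sum_(i < n) u i 0 * v i 0).
  by rewrite -!sqr_norm2; ring.
by rewrite !mulr_sumr -big_split -sumrB; apply: eq_bigr => i _ /=; ring.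
Qed.

Lemma ler_norm2D n (u v : 'cV[R]_n) : norm2 (u + v) <= norm2 u + norm2 v.
Proof.
rewrite -(@ler_pXn2r _ 2)// ?nnegrE ?addr_ge0 ?norm2_ge0// sqrrD !sqr_norm2.
under eq_bigr do rewrite mxE sqrrD.
rewrite !big_split/= lerD2r lerD2l mulr2n.
by apply: lerD; exact: norm2_cauchy_schwarz.
Qed.

(** Source of the [sqrt 3] (whole deviation) and [sqrt 2] (horizontal part) in the margins. *)
Lemma norm2_le n (v : 'cV[R]_n) c :
  0 <= c -> (forall i, `|v i 0| <= c) -> norm2 v <= Num.sqrt n%:R * c.
Proof.
move=> c0 vc; rewrite -[leRHS]ger0_norm ?mulr_ge0 ?sqrtr_ge0//.
rewrite -sqrtr_sqr ler_wsqrtr// exprMn sqr_sqrtr ?ler0n//.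
rewrite mulr_natl -[n in leRHS]card_ord -sumr_const ler_sum// => i _.
by rewrite -real_normK ?num_real// ler_pXn2r ?nnegrE.
Qed.

(** Serves to read the initial conditions, stated in the maximum norm, coordinate by coordinate. *)
Lemma ler_mx_norm_coord m n (M : 'M[R]_(m, n)) i j : `|M i j| <= `|M|.
Proof.
rewrite [leRHS]/Num.norm /= mx_normrE.
exact: (le_bigmax _ (fun ij => `|M ij.1 ij.2|) (i, j)).
Qed.

End EuclideanNorm.

(** * From norm bounds on the virtual input to thrust and angle bounds *)

Section InputBounds.
Context {R : realType}.

(** The thrust direction is a unit vector, so [norm2 (Psi g v + g *: zW)] is the absolute value of
    the thrust. *)
Lemma norm2_zB (v : 'cV[R]_4) : norm2 (zB v) = 1.
Proof.
rewrite -[RHS]sqrtr1; congr Num.sqrt; rewrite !big_ord_recr big_ord0 !mxE/=.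
set ph := roll v; set th := pitch v; set ps := yaw v.
transitivity (sin ph ^+ 2 * (cos ps ^+ 2 + sin ps ^+ 2) + cos ph ^+ 2 *
    (sin th ^+ 2 * (cos ps ^+ 2 + sin ps ^+ 2) + cos th ^+ 2)); first by ring.
by rewrite cos2Dsin2 !mulr1 [sin th ^+ 2 + _]addrC cos2Dsin2 mulr1 addrC
  cos2Dsin2.
Qed.

(* At [d = 0] the quotient is [0], so [d] need not be positive. *)
Lemma normr_atan_le (eps p d : R) :
  0 < eps < pi / 2 -> `|cot eps| * `|p| <= d -> `|atan (p / d)| <= eps.
Proof.
move=> /andP[eps0 epspi] pd.
have epsI : eps \in `](- (pi / 2)), (pi / 2)[%R.
  rewrite in_itv/= epspi andbT (lt_trans _ eps0)// oppr_lt0.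
  by rewrite divr_gt0 ?pi_gt0.
have c0 : 0 < cos eps by apply: cos_gt0_pihalf; rewrite in_itv in epsI.
have s0 : 0 < sin eps.
  by apply: sin_gt0_pi; rewrite eps0 (lt_trans epspi)// ltr_pdivrMr//
    ltr_pMr ?pi_gt0// ltr1n.
(* Since [atan] is odd and increasing, it is enough to bound the quotient by [tan eps], the inverse
   of [cot eps]. *)
have pdt : `|p / d| <= tan eps.
  have [->|d0] := eqVneq d 0.
    by rewrite invr0 mulr0 normr0 divr_ge0// ltW.
  have d_gt0 : 0 < d by rewrite lt0r d0 (le_trans _ pd)// mulr_ge0.
  move: pd; rewrite /cot gtr0_norm ?divr_gt0// => pd.
  rewrite normrM normfV (gtr0_norm d_gt0) ler_pdivrMr// /tan.
  rewrite -(ler_pM2l (divr_gt0 c0 s0)) (le_trans pd)//.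
  by rewrite mulrA -invf_div mulVf ?mul1r// gt_eqF// divr_gt0.
move: pdt; rewrite !ler_norml => /andP[/le_atan + /le_atan].
by rewrite atanN tanK// => -> ->.
Qed.

Lemma norm2_cV3 (v : 'cV[R]_3) :
  norm2 v = Num.sqrt (v 0 0 ^+ 2 + v 1 0 ^+ 2 + v 2 0 ^+ 2).
Proof.
rewrite /norm2 !big_ord_recr big_ord0 /= add0r.
by congr (Num.sqrt (v _ _ ^+ 2 + v _ _ ^+ 2 + v _ _ ^+ 2)); exact/val_inj.
Qed.

(** Typed as a 2-vector so that [norm2_le] yields [sqrt 2] instead of [sqrt 3]. *)
Definition horizontal (v : 'cV[R]_3) : 'cV[R]_2 :=
  \col_(i < 2) v (widen_ord (leqnSn 2) i) 0.

Lemma norm2_horizontal (v : 'cV[R]_3) :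
  norm2 (horizontal v) = Num.sqrt (v 0 0 ^+ 2 + v 1 0 ^+ 2).
Proof.
rewrite /norm2 !big_ord_recr big_ord0 /= add0r !mxE.
by congr (Num.sqrt (v _ _ ^+ 2 + v _ _ ^+ 2)); exact/val_inj.
Qed.

Lemma norm2_Aeps eps (v : 'cV[R]_3) :
  norm2 (Aeps eps *m v) = `|cot eps| * norm2 (horizontal v).
Proof.
rewrite -scalemxAl norm2Z normr_id norm2_horizontal norm2_cV3 mul_diag_mx.
by rewrite !mxE/= !mul1r mul0r expr0n addr0.
Qed.

(** The thrust of [Psi_inv] is exactly [norm2 (mu + g *: zW)], and the cone condition controls both
    arctangent quotients. *)
Lemma Psi_inv_safe g (mu : 'cV[R]_3) psi eps Tbar :
  0 < eps < pi / 2 -> norm2 (mu + g *: zW) <= Tbar ->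
  norm2 (Aeps eps *m mu) <= mu 2 0 + g ->
  safe_inputs Tbar eps (Psi_inv g mu psi).
Proof.
move=> epsB; rewrite norm2_cV3 !mxE/= !mulr0 !addr0 mulr1 => TB.
rewrite norm2_Aeps => angleB.
have horiz p q : p ^+ 2 + q ^+ 2 = mu 0 0 ^+ 2 + mu 1 0 ^+ 2 ->
    `|p| <= norm2 (horizontal mu).
  move=> pq; rewrite -sqrtr_sqr norm2_horizontal ler_wsqrtr// -pq.
  by rewrite lerDl sqr_ge0.
pose m1 := mu 0 0; pose m2 := mu 1 0; pose c := cos psi; pose s := sin psi.
pose p := m1 * c + m2 * s; pose q := m1 * s - m2 * c.
(* [(p, q)] is an orthogonal image of [(m1, m2)], so neither component exceeds the horizontal
   norm. *)
have pq : p ^+ 2 + q ^+ 2 = m1 ^+ 2 + m2 ^+ 2.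
  transitivity ((m1 ^+ 2 + m2 ^+ 2) * (c ^+ 2 + s ^+ 2)).
    by rewrite /p/q; ring.
  by rewrite cos2Dsin2 mulr1.
split; last split.
- by rewrite /thrust mxE/= sqrtr_ge0.
(* The cosine of the pitch is moved into the numerator, where it can only shrink [q]. *)
- rewrite /roll mxE/= -/m1 -/m2 -/s -/c -/q mulrAC.
  apply: normr_atan_le => //; apply: le_trans angleB; rewrite ler_wpM2l//.
  apply: le_trans (horiz q p _); last by rewrite addrC.
  by rewrite normrM ler_piMr// ler_norml cos_geN1 cos_le1.
- rewrite /pitch mxE/= -/m1 -/m2 -/s -/c -/p.
  apply: normr_atan_le => //; apply: le_trans angleB; rewrite ler_wpM2l//.
  exact: horiz pq.
Qed.

End InputBounds.

(** * The closed loop and the safety of its inputs *)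

Section ClosedLoop.
Context {R : realType}.

Lemma dynamicsE (z : 'cV[R]_(3 + 3)) (mu : 'cV[R]_3) :
  Amx *m z + Bmx *m mu = col_mx (velocity z) mu.
Proof.
rewrite -[z in LHS]vsubmxK mul_block_col mul_col_mx add_col_mx.
by rewrite !mul0mx !mul1mx !addr0 !add0r.
Qed.

(** The two barrier constraints are the two halves of a single absolute value bound. *)
Lemma qp_feasible_norm_le (a1 a2 delta : R) (r dr ddr : 'cV[R]_3) z mu q :
  qp_feasible a1 a2 delta r dr ddr z mu ->
  `|(mu q 0 - ddr q 0) + a1 * (velocity z q 0 - dr q 0)
    + a2 * (position z q 0 - r q 0)| <= a2 * delta.
Proof. by move=> /(_ q)[? ?]; rewrite ler_norml; apply/andP; split; nra. Qed.

(** Evaluation at 0 gives the product, and evaluation at 1 then gives the sum. *)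
Lemma char_poly_coefs (a1 a2 l1 l2 : R) :
  'X^2 + a1 *: 'X + a2%:P = ('X - (- l1)%:P) * ('X - (- l2)%:P) ->
  a1 = l1 + l2 /\ a2 = l1 * l2.
Proof.
move=> roots; have /(congr1 (fun p => p.[0])) := roots.
have /(congr1 (fun p => p.[1])) := roots.
by rewrite !hornerE => ? ?; split; nra.
Qed.

End ClosedLoop.

Theorem proposition3 (R : realType) (g delta a1 a2 l1 l2 eps Tbar tau0 : R)
    (tauv : \bar R)
    (r dr ddr dddr : R -> 'cV[R]_3)
    (vref : R -> 'cV[R]_4)
    (ctrl : 'cV[R]_(3 + 3) -> 'cV[R]_4)
    (mustar : R -> 'cV[R]_(3 + 3) -> 'cV[R]_3)
    (z : R -> 'cV[R]_(3 + 3))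
    (g_gt0 : 0 < g) (delta_gt0 : 0 < delta)
    (r_C1 : is_derivative_in (horizon tau0 tauv) r dr)
    (r_C2 : is_derivative_in (horizon tau0 tauv) dr ddr)
    (r_C3 : is_derivative_in (horizon tau0 tauv) ddr dddr)
    (dddr_continuous : {within horizon tau0 tauv, continuous dddr})
    (mustar_qp : forall t x, horizon tau0 tauv t ->
       qp_solution g a1 a2 delta (r t) (dr t) (ddr t) ctrl x (mustar t x))
    (closed_loop : is_derivative_in (horizon tau0 tauv) z
       (fun t => Amx *m z t + Bmx *m mustar t (z t)))
    (a1_gt0 : 0 < a1) (a2_gt0 : 0 < a2)
    (l1_gt0 : 0 < l1) (l2_gt0 : 0 < l2) (l1_le_l2 : l1 <= l2)
    (roots : 'X^2 + a1 *: 'X + a2%:P =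
             ('X - (- l1)%:P) * ('X - (- l2)%:P))
    (init_pos : `|position (z tau0) - r tau0| <= delta)
    (init_vel : `|velocity (z tau0) - dr tau0
                  + l1 *: (position (z tau0) - r tau0)| <= l1 * delta)
    (mustar_lip : forall t, horizon tau0 tauv t ->
       locally_lipschitz (mustar t))
    (eps_bounds : 0 < eps < pi / 2)
    (ref_feasible : forall t, horizon tau0 tauv t -> ddr t = Psi g (vref t))
    (thrust_cond : forall t, horizon tau0 tauv t ->
       0 <= thrust (vref t) <= Tbar - 4 * Num.sqrt 3 * delta * a2)
    (angle_cond : forall t, horizon tau0 tauv t ->
       norm2 (Aeps eps *m ddr t) <=
       ddr t 2 0 + g - 4 * delta * a2 * (1 + `|cot eps| * Num.sqrt 2)) :
  forall t, horizon tau0 tauv t ->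
    safe_inputs Tbar eps
      (Psi_inv g (mustar t (z t)) (yaw (ctrl (z t)))).
Proof.
have [a1E a2E] := char_poly_coefs roots.
have dev_ge0 : 0 <= 4 * delta * a2 by rewrite !mulr_ge0 // ltW.
have dzE : (fun t => Amx *m z t + Bmx *m mustar t (z t)) =
    (fun t => col_mx (velocity (z t)) (mustar t (z t))).
  by apply/funext => t; exact: dynamicsE.
rewrite dzE in closed_loop.
have mu_close t : horizon tau0 tauv t ->
    forall q, `|(mustar t (z t) - ddr t) q 0| <= 4 * delta * a2.
  move=> tD q.
  pose e u : R^o := position (z u) q 0 - r u q 0.
  pose e' u : R^o := velocity (z u) q 0 - dr u q 0.
  pose e'' u : R^o := mustar u (z u) q 0 - ddr u q 0.
  have de : is_derivative_in (horizon tau0 tauv) e e'.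
    have := is_derivative_inD
      (is_derivative_in_coord (i := lshift 3 q) (j := 0) closed_loop)
      (is_derivative_inN (is_derivative_in_coord (i := q) (j := 0) r_C1)).
    by congr is_derivative_in; apply/funext => u; rewrite ?col_mxEu// /e mxE.
  have de' : is_derivative_in (horizon tau0 tauv) e' e''.
    have := is_derivative_inD
      (is_derivative_in_coord (i := rshift 3 q) (j := 0) closed_loop)
      (is_derivative_inN (is_derivative_in_coord (i := q) (j := 0) r_C2)).
    by congr is_derivative_in; apply/funext => u; rewrite ?col_mxEd// /e' mxE.
  rewrite !mxE a2E; apply: (second_order_norm_le l1_gt0 l1_le_l2 de de') => //.
  - move=> u uD; rewrite -a1E -a2E; apply: qp_feasible_norm_le.
    by have [] := mustar_qp u (z u) uD.
  - have := ler_mx_norm_coord (position (z tau0) - r tau0) q 0.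
    by rewrite /e' /e !mxE => /le_trans; exact.
  - have := ler_mx_norm_coord (velocity (z tau0) - dr tau0 +
      l1 *: (position (z tau0) - r tau0)) q 0.
    by rewrite /e' /e !mxE => /le_trans; exact.
move=> t tD; have closeE : mustar t (z t) = ddr t + (mustar t (z t) - ddr t).
  by rewrite subrKC.
apply: Psi_inv_safe => //.
- have /andP[T0 TB] := thrust_cond t tD.
  have refE : norm2 (ddr t + g *: zW) = thrust (vref t).
    by rewrite ref_feasible// subrK norm2Z norm2_zB mulr1 ger0_norm.
  rewrite closeE addrAC; apply: le_trans (ler_norm2D _ _) _; rewrite refE.
  (* The deviation from [ddr t] has Euclidean norm at most [sqrt 3 * (4 delta a2)], exactly the
     margin left below [Tbar]. *)
  apply: le_trans (lerD TB (norm2_le dev_ge0 (mu_close t tD))) _.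
  lra.
- have horizB : norm2 (horizontal (mustar t (z t) - ddr t)) <=
      Num.sqrt 2%:R * (4 * delta * a2).
    by apply: norm2_le => // i; rewrite mxE; exact: mu_close.
  have : `|(mustar t (z t) - ddr t) 2 0| <= 4 * delta * a2 by exact: mu_close.
  rewrite !mxE ler_norml => /andP[vertB _].
  rewrite [in leLHS]closeE mulmxDr (le_trans (ler_norm2D _ _))//.
  rewrite [X in _ + X <= _]norm2_Aeps.
  (* The deviation costs twice: at most [|cot eps| * sqrt 2 * (4 delta a2)] on the left, and at most
     [4 delta a2] in the vertical component on the right. The sum is the margin in [angle_cond]. *)
  apply: le_trans (lerD (angle_cond t tD) (ler_wpM2l _ horizB)) _ => //.
  lra.
Qed.
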